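(* Let $X$ and $Y$ be metric spaces that are sparse at infinity and quasi-isometric to each other. If the sparsity order at infinity $\sigma(X)$ exists, then $\sigma(Y)$ exists and $\sigma(Y)=\sigma(X)$.
   Context: Let $(X,d)$ be an unbounded metric space with a base point $x_0\in X$, and let $B(x_0,R)$ be the open ball of radius $R$ centered at $x_0$. For $R>0$ put $s(R)=\inf\{d(x,y): x,y\in X\setminus B(x_0,R),\ x\neq y\}$. The function $s$ is nondecreasing. The space $X$ is called sparse at infinity (or sparse) if it is unbounded and $\lim_{R\to\infty}s(R)=\infty$; this does not depend on $x_0$. For a sparse space $X$, the lower and upper sparsity orders at infinity are $\underline{\sigma}(X)=\liminf_{R\to\infty}\frac{\log s(R)}{\log R}$ and $\overline{\sigma}(X)=\limsup_{R\to\infty}\frac{\log s(R)}{\log R}$ (values in $[0,\infty]$; they do not depend on $x_0$). If $\underline{\sigma}(X)=\overline{\sigma}(X)$, we say that the sparsity order at infinity $\sigma(X)$ exists and it denotes this common value. A map $\varphi:X\to Y$ of metric spaces is a $(C,A)$-quasi-isometry (with constants $C\ge 1$, $A\ge 0$) if $C^{-1}d(x,x')-A\le d(\varphi(x),\varphi(x'))\le C\,d(x,x')+A$ for all $x,x'\in X$ and for every $y\in Y$ there is $x\in X$ with $d(y,\varphi(x))\le A$. $X$ and $Y$ are quasi-isometric if there is a $(C,A)$-quasi-isometry $X\to Y$ for some $C,A$. *)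

(* Defs.v *)
From mathcomp Require Import all_boot all_order all_algebra.
From mathcomp Require Import all_classical all_reals all_analysis.

Set Implicit Arguments.
Unset Strict Implicit.
Unset Printing Implicit Defensive.

Import Order.TTheory GRing.Theory Num.Theory.
Import numFieldNormedType.Exports.

Local Open Scope classical_set_scope.
Local Open Scope ring_scope.

Definition unbounded (R : realType) (X : metricType R) : Prop :=
  ~ exists M : R, forall x y : X, mdist x y <= M.

(* [inf] is the real infimum. If X is unbounded, the set below is nonempty for
   every r (and bounded below by 0), so the default value of [inf] is not met. *)
Definition sep (R : realType) (X : metricType R) (x0 : X) (r : R) : R :=
  inf [set d : R | exists x y : X,
         [/\ ~ ball x0 r x, ~ ball x0 r y, x <> y & d = mdist x y]].

(* Sparsity and the sparsity orders do not depend on the base point, which is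
   kept as a parameter of the definitions. *)
Definition sparse (R : realType) (X : metricType R) (x0 : X) : Prop :=
  unbounded X /\ sep x0 r @[r --> +oo_R] --> +oo_R.

(* [ln] is 0 outside of the positive reals; in a sparse space [sep x0 r] is
   positive for all large r, so this does not affect the limits at infinity. *)
Definition lower_sparsity_order (R : realType) (X : metricType R) (x0 : X)
    : \bar R :=
  limf_einf (fun r : R => (ln (sep x0 r) / ln r)%:E) +oo_R.

Definition upper_sparsity_order (R : realType) (X : metricType R) (x0 : X)
    : \bar R :=
  limf_esup (fun r : R => (ln (sep x0 r) / ln r)%:E) +oo_R.

Definition sparsity_order_exists (R : realType) (X : metricType R) (x0 : X)
    : Prop :=
  lower_sparsity_order x0 = upper_sparsity_order x0.

(* Meaningful only under [sparsity_order_exists x0]: it is then the common value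
   of the lower and upper orders. *)
Definition sparsity_order (R : realType) (X : metricType R) (x0 : X) : \bar R :=
  lower_sparsity_order x0.

Definition quasi_isometry (R : realType) (X Y : metricType R) (C A : R)
    (phi : X -> Y) : Prop :=
  [/\ 1 <= C, 0 <= A,
      forall x x' : X,
        C^-1 * mdist x x' - A <= mdist (phi x) (phi x') <= C * mdist x x' + A
    & forall y : Y, exists x : X, mdist y (phi x) <= A].

Definition quasi_isometric (R : realType) (X Y : metricType R) : Prop :=
  exists (C A : R) (phi : X -> Y), quasi_isometry C A phi.

(* Main.v *)
(** Write [s_X] for [sep x0]. A quasi-isometric embedding of [Y] into [X] gives
    [a * s_X (a * r) <= s_Y r] for some [a > 0] and all large [r]: two distinct
    points far out in [Y] are so far apart, by sparsity, that they have distinct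
    images, and these images are far out in [X]. After taking logarithms the
    constant [a] only costs a bounded additive term and a rescaling of [r],
    neither of which affects the limits of [ln (s r) / ln r]. Hence both orders
    of [X] are at most those of [Y]; a quasi-isometry and a quasi-inverse of it
    give both inequalities. *)
Require Import Defs.
From mathcomp Require Import all_boot all_order all_algebra.
From mathcomp Require Import all_classical all_reals all_analysis.
From mathcomp Require Import lra.

Set Implicit Arguments.
Unset Strict Implicit.
Unset Printing Implicit Defensive.

Import Order.TTheory GRing.Theory Num.Theory.
Import numFieldNormedType.Exports.

Local Open Scope classical_set_scope.
Local Open Scope ring_scope.

Section limf_esup_near.
Context {R : realType} {T : choiceType} {X : filteredType T}.
Context (F : set_system X) {FF : Filter F}.
Implicit Types (f : X -> \bar R) (M : \bar R).

Lemma limf_esup_near_lt f M :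
  (limf_esup f F < M)%E -> \forall x \near F, (f x < M)%E.
Proof.
move=> /ereal_inf_lt[_ [V FV <-]] ltM; apply: filterS FV => x Vx.
by apply: le_lt_trans ltM; apply: ereal_sup_ubound; exists x.
Qed.

Lemma limf_esup_near_le f M :
  (\forall x \near F, (f x <= M)%E) -> (limf_esup f F <= M)%E.
Proof.
move=> FM; apply: ge_ereal_inf; exists (ereal_sup (f @` [set x | (f x <= M)%E])).
  by exists [set x | (f x <= M)%E].
by apply: ge_ereal_sup => _ [x fxM <-].
Qed.

End limf_esup_near.

(** Allows an upper limit to be bounded through real thresholds alone, so that infinite orders need
    no separate argument. *)
Lemma le_ereal_gt_fin (R : realType) (x y : \bar R) :
  (forall t : R, (y < t%:E)%E -> (x <= t%:E)%E) -> (x <= y)%E.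
Proof.
case: y => [y| |] H; last 2 first.
- exact: leey.
- by rewrite (eq_ninfty (fun t => H t (ltNyr t))).
apply/lee_addgt0Pr => e e0; rewrite -EFinD; apply: H.
by rewrite lte_fin ltrDl.
Qed.

Section log_order.
Context {R : realType}.
Implicit Types (p q : R -> R) (a c : R).

Lemma near_pinfty_scale a (P : set R) : 0 < a ->
  (\forall r \near +oo_R, P r) -> \forall r \near +oo_R, P (r * a).
Proof. by move=> a0 nP; exact: (gt0_cvgMly a0 cvg_id nP). Qed.

Lemma near_pinfty_ln_gt (M : R) : \forall r \near +oo_R, 0 < r /\ M < ln r.
Proof.
near=> r.
have r0 : expR M < r by near: r; exact: nbhs_pinfty_gt (num_real _).
have r1 : 0 < r := lt_trans (expR_gt0 M) r0.
by split=> //; rewrite -ltr_expR lnK.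
Unshelve. all: by end_near.
Qed.

(** For a real [t] above the right-hand side, substituting [r / a] for [r] gives
    [p r <= t * (ln r - ln a) + c] for large [r]. The constant [c - t * ln a] is negligible against
    [ln r]. *)
Lemma limf_esup_log_order_le p q a c : 0 < a ->
  (\forall r \near +oo_R, p (r * a) <= q r + c) ->
  (limf_esup (fun r : R => (p r / ln r)%:E) +oo_R <=
   limf_esup (fun r : R => (q r / ln r)%:E) +oo_R)%E.
Proof.
move=> a0 pq; apply: le_ereal_gt_fin => t /limf_esup_near_lt qt.
apply/lee_addgt0Pr => e e0; rewrite -EFinD; apply: limf_esup_near_le.
have ia0 : 0 < a^-1 by rewrite invr_gt0.
have qt' := near_pinfty_scale ia0 qt.
have pq' := near_pinfty_scale ia0 pq.
have lnr' := near_pinfty_scale ia0 (near_pinfty_ln_gt 0).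
near=> r.
have [r0 lnr0] : 0 < r /\ 0 < ln r by near: r; exact: near_pinfty_ln_gt.
(* This threshold makes [c - t * ln a] smaller than [e * ln r]. *)
have [_ lnr] : 0 < r /\ (c - t * ln a) / e < ln r.
  by near: r; exact: near_pinfty_ln_gt.
have [ra0 lnra0] : 0 < r / a /\ 0 < ln (r / a) by near: r.
have {}qt : ((q (r / a) / ln (r / a))%:E < t%:E)%E by near: r.
have {}pq : p (r / a * a) <= q (r / a) + c by near: r.
rewrite lee_fin ler_pdivrMr//.
move: qt pq; rewrite lte_fin ltr_pdivrMr// mulfVK ?gt_eqF//.
rewrite ln_div ?posrE// => qt pq.
move: lnr; rewrite ltr_pdivrMr// => lnr.
nra.
Unshelve. all: by end_near.
Qed.

(** By negation this is the upper-limit case for [- q] and [- p]: replacing [r] by [r / a] in the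
    hypothesis swaps the two functions and turns [a] into [a^-1]. *)
Lemma limf_einf_log_order_le p q a c : 0 < a ->
  (\forall r \near +oo_R, p (r * a) <= q r + c) ->
  (limf_einf (fun r : R => (p r / ln r)%:E) +oo_R <=
   limf_einf (fun r : R => (q r / ln r)%:E) +oo_R)%E.
Proof.
move=> a0 pq; rewrite /limf_einf leeN2.
have E (f : R -> R) : (\- (fun r : R => (f r / ln r)%:E))%E
    = (fun r => ((- f r) / ln r)%:E).
  by apply/funext => r; rewrite -EFinN mulNr.
rewrite !E; have ia0 : 0 < a^-1 by rewrite invr_gt0.
apply: (@limf_esup_log_order_le _ _ a^-1 c) => //.
apply: filterS (near_pinfty_scale ia0 pq) => r.
by rewrite mulfVK ?gt_eqF//; lra.
Qed.

End log_order.

Section sep.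
Context {R : realType}.
Implicit Types X Y : metricType R.

Lemma sep_le X (x0 x y : X) r :
  r <= mdist x0 x -> r <= mdist x0 y -> x <> y -> sep x0 r <= mdist x y.
Proof.
move=> rx ry xy; apply: ge_inf.
  by exists 0 => _ [? [? [_ _ _ ->]]]; exact: mdist_ge0.
by exists x, y; rewrite !ballEmdist /=; split=> //; apply/negP; rewrite -leNgt.
Qed.

(** Positivity of [sep x0 r] rules out the empty set, whose [inf] is 0 by default. *)
Lemma le_sep X (x0 : X) r c : 0 < sep x0 r ->
  (forall x y, r <= mdist x0 x -> r <= mdist x0 y -> x <> y -> c <= mdist x y) ->
  c <= sep x0 r.
Proof.
rewrite /sep; set S := [set d | _] => s0 H.
apply: lb_le_inf => [|_ [x [y [rx ry xy ->]]]].
  by apply/set0P/eqP => S0; move: s0; rewrite S0 inf0 ltxx.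
by move: rx ry; rewrite !ballEmdist /= => /negP + /negP; rewrite -!leNgt => *; exact: H.
Qed.

Lemma sep_embedding_le X Y (x0 : X) (y0 : Y) (C A : R) (f : Y -> X) :
  1 <= C -> 0 <= A ->
  (forall y y', C^-1 * mdist y y' - A <= mdist (f y) (f y') <= C * mdist y y' + A) ->
  sep y0 r @[r --> +oo_R] --> +oo_R ->
  exists2 a : R, 0 < a & \forall r \near +oo_R, a * sep x0 (r * a) <= sep y0 r.
Proof.
move=> C1 A0 fqi /cvgryPgt sY.
have C0 : 0 < C by lra.
(* The factor 2 leaves room to absorb the additive errors, both in the distance of images from [x0]
   and in the upper bound [C * mdist y y' + A]. *)
exists (2 * C)^-1; first by rewrite invr_gt0 mulr_gt0.
near=> r.
(* Points with equal images are at distance at most [C * A], so this separates the images of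
   distinct far points. It also yields [A <= C * mdist y y'], used at the end. *)
have sCA : C * A < sep y0 r by near: r; exact: sY.
have rbig : 2 * C * (A + mdist x0 (f y0)) < r.
  by near: r; exact: nbhs_pinfty_gt (num_real _).
have CA0 : 0 <= C * A by rewrite mulr_ge0// ltW.
have far y : r <= mdist y0 y -> r * (2 * C)^-1 <= mdist x0 (f y).
  move=> ry; have /andP[+ _] := fqi y0 y.
  have := metric_triangle (f y0) x0 (f y); rewrite (metric_sym (f y0) x0).
  move: rbig; rewrite -ltr_pdivlMl ?mulr_gt0//.
  have : C^-1 * r <= C^-1 * mdist y0 y by rewrite ler_pM2l// invr_gt0.
  rewrite invfM; lra.
apply: le_sep => [|y y' ry ry' yy']; first lra.
have dyy' : C * A < mdist y y' by apply: lt_le_trans sCA _; exact: sep_le.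
have /andP[lo up] := fqi y y'.
rewrite ler_pdivrMl ?mulr_gt0//.
have : sep x0 (r / (2 * C)) <= mdist (f y) (f y').
  apply: sep_le; [exact: far|exact: far|] => ff.
  move: lo; rewrite ff mdistxx subr_le0 ler_pdivrMl//; lra.
nra.
Unshelve. all: by end_near.
Qed.

Lemma sparsity_orders_embedding_le X Y (x0 : X) (y0 : Y) (C A : R) (f : Y -> X) :
  sparse x0 -> sparse y0 -> 1 <= C -> 0 <= A ->
  (forall y y', C^-1 * mdist y y' - A <= mdist (f y) (f y') <= C * mdist y y' + A) ->
  (lower_sparsity_order x0 <= lower_sparsity_order y0)%E /\
  (upper_sparsity_order x0 <= upper_sparsity_order y0)%E.
Proof.
move=> [_ /cvgryPgt sX] [_ sY] C1 A0 fqi.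
have [a a0 sXY] := sep_embedding_le x0 C1 A0 fqi sY.
have lnXY : \forall r \near +oo_R,
    ln (sep x0 (r * a)) <= ln (sep y0 r) + - ln a.
  (* Both separations must be positive for [ln] to be additive and monotone on them. *)
  have sX0 := near_pinfty_scale a0 (sX 0).
  apply: filterS2 sX0 sXY => r /= {}sX0 {}sXY.
  rewrite -lerBlDr opprK addrC -lnM ?posrE// ler_ln ?posrE ?mulr_gt0//.
  by apply: lt_le_trans sXY; rewrite mulr_gt0.
split; [exact: limf_einf_log_order_le lnXY|exact: limf_esup_log_order_le lnXY].
Qed.

(** Let [psi y] be a point whose image lies within [A] of [y]. Replacing [y] and [y'] by these
    images costs [2 * A], and [phi] itself adds another [A]; a factor [C] covers the rescaling. *)
Lemma quasi_isometry_inverse X Y C A (phi : X -> Y) :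
  quasi_isometry C A phi -> exists psi : Y -> X, forall y y',
  C^-1 * mdist y y' - 3 * C * A <= mdist (psi y) (psi y')
    <= C * mdist y y' + 3 * C * A.
Proof.
move=> [C1 A0 phiqi /choice[psi psiK]]; exists psi => y y'.
have C0 : 0 < C by lra.
have /andP[lo up] := phiqi (psi y) (psi y').
have Ky := psiK y; have Ky' := psiK y'.
have t1 := metric_triangle y (phi (psi y)) y'.
have t2 := metric_triangle (phi (psi y)) (phi (psi y')) y'.
have t3 := metric_triangle (phi (psi y)) y (phi (psi y')).
have t4 := metric_triangle y y' (phi (psi y')).
rewrite (metric_sym (phi (psi y')) y') in t2.
rewrite (metric_sym (phi (psi y)) y) in t3.
apply/andP; split.
  rewrite lerBlDr ler_pdivrMl//.
  have A_CA : A <= C * A by rewrite ler_peMl.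
  have : C * A <= C * (C * A) by rewrite ler_pM2l.
  lra.
have : mdist (psi y) (psi y') <= C * (mdist y y' + 3 * A).
  rewrite -ler_pdivrMl//; lra.
lra.
Qed.

End sep.

Theorem proposition2p5 (R : realType) (X Y : metricType R) (x0 : X) (y0 : Y)
    (sparseX : sparse x0) (sparseY : sparse y0)
    (qiXY : quasi_isometric X Y)
    (sigmaX : sparsity_order_exists x0) :
  sparsity_order_exists y0 /\ sparsity_order y0 = sparsity_order x0.
Proof.
have [C [A [phi qi]]] := qiXY.
have [psi psiqi] := quasi_isometry_inverse qi.
have [C1 A0 phiqi _] := qi.
(* [phi] bounds the orders of [Y] by those of [X]; [psi] gives the reverse. *)
have [lowYX upYX] := sparsity_orders_embedding_le sparseY sparseX C1 A0 phiqi.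
have A0' : 0 <= 3 * C * A by rewrite !mulr_ge0//; lra.
have [lowXY upXY] := sparsity_orders_embedding_le sparseX sparseY C1 A0' psiqi.
have low : lower_sparsity_order y0 = lower_sparsity_order x0.
  by apply/eqP; rewrite eq_le lowYX.
have up : upper_sparsity_order y0 = upper_sparsity_order x0.
  by apply/eqP; rewrite eq_le upYX.
by split=> //; rewrite /sparsity_order_exists low up.
Qed.
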